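(* In dimension $n=2$, the absolute minimum of $E(2,a)$ among $a\in[0,2)$ is attained at a non-zero cutoff $a$.
   Context: Here $\|\cdot\|$ is the Euclidean norm on $\mathbb{R}^n$, $e_1$ is the first canonical basis vector and $x_1$ is the first coordinate of $x\in\mathbb{R}^n$. For $a\in\mathbb{R}$, $\mathbb{S}_a=\{x\in\mathbb{R}^n:\|x-ae_1\|=1\}$ and $\sigma_a$ is the normalized (total mass one) surface measure on $\mathbb{S}_a$: $\sigma_0$ is the rotation-invariant Borel probability measure on the unit sphere $\mathbb{S}_0$, and $\sigma_a(A+ae_1)=\sigma_0(A)$ for Borel sets $A$. Let $\rho=\frac12(\sigma_{-1}+\sigma_1)$, a Borel probability measure with support $S=\mathbb{S}_{-1}\cup\mathbb{S}_1$. Mean-squared error: for a Borel measurable subset $S_1\subset S$ with complement $S_2=S\setminus S_1$, $$\mathcal{E}(S_1)=\min_{c_1\in\mathbb{R}^n}\int_{S_1}\|x-c_1\|^2\,d\rho(x)+\min_{c_2\in\mathbb{R}^n}\int_{S_2}\|x-c_2\|^2\,d\rho(x).$$ For the measure $\rho$ in dimension $n$, set $E(n,a)=\mathcal{E}(\{x\in S: x_1\le -a\})$. *)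

(* Defs.v *)
From HB Require Import structures.
From mathcomp Require Import all_boot all_order all_algebra.
From mathcomp Require Import all_classical all_reals all_analysis.

Set Implicit Arguments.
Unset Strict Implicit.
Unset Printing Implicit Defensive.
Import Order.TTheory GRing.Theory Num.Theory.
Import numFieldNormedType.Exports.

Local Open Scope classical_set_scope.
Local Open Scope ring_scope.

(* R^n with its Borel sigma-algebra. The norm that the library puts on 'rV[R]_n
   is the sup norm; it is used here only for the topology it generates. *)
Notation borel_rV R n := (g_sigma_algebraType (@open 'rV[R]_n)).

Definition enorm (R : realType) (n : nat) (x : 'rV[R]_n) : R :=
  Num.sqrt (\sum_(i < n) x 0 i ^+ 2).

(* From here on the ambient space is R^(n+1), so that a first coordinate
   exists. *)
Definition e1 (R : realType) (n : nat) : 'rV[R]_n.+1 := delta_mx 0 0.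
Arguments e1 {R n}.

Definition sphere (R : realType) (n : nat) (a : R) : set 'rV[R]_n.+1 :=
  [set x | enorm (x - a *: e1) = 1].
Arguments sphere {R n}.

(* This characterizes the normalized surface measure of the unit sphere. The
   full orthogonal group is used because the rotations of determinant 1 do not
   determine a probability measure on the two-point sphere of R^1. *)
Definition is_uniform_on_sphere (R : realType) (n : nat)
    (sigma : probability (borel_rV R n.+1) R) : Prop :=
  sigma (sphere 0) = 1%E /\
  forall U : 'M[R]_n.+1, U *m U^T = 1%:M ->
  forall A : set (borel_rV R n.+1), measurable A ->
    sigma ((fun x : 'rV[R]_n.+1 => x *m U) @^-1` A) = sigma A.

Definition shift_e1 (R : realType) (n : nat) (a : R) (x : borel_rV R n.+1) :
  borel_rV R n.+1 := (x : 'rV[R]_n.+1) + a *: e1.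

Lemma measurable_shift_e1 (R : realType) (n : nat) (a : R) :
  measurable_fun [set: borel_rV R n.+1] (@shift_e1 R n a).
Proof.
apply: (@measurability _ _ (borel_rV R n.+1) (borel_rV R n.+1) setT
  (@shift_e1 R n a) (@open 'rV[R]_n.+1)) => //.
move=> _ [B oB <-]; rewrite setTI.
apply: (@sub_sigma_algebra _ setT (@open 'rV[R]_n.+1)).
have cf : continuous (fun x : 'rV[R]_n.+1 => x + a *: e1).
  move=> x; apply: cvgD; [exact: nbhs_filter|exact: cvg_id|].
  by apply: cvg_cst; exact: nbhs_filter.
exact: (proj1 (continuousP _) cf).
Qed.

HB.instance Definition _ (R : realType) (n : nat) (a : R) :=
  isMeasurableFun.Build _ _ _ _ (@shift_e1 R n a) (@measurable_shift_e1 R n a).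

Section two_spheres.
Context (R : realType) (n : nat) (sigma : probability (borel_rV R n.+1) R).

Definition sphere_measure (a : R) : probability (borel_rV R n.+1) R :=
  distribution sigma (@shift_e1 R n a).

Definition rho : set (borel_rV R n.+1) -> \bar R :=
  mscale (2^-1 : R)%:nng
    (measure_add (sphere_measure (-1)) (sphere_measure 1)).

HB.instance Definition _ := Measure.on rho.

Let rho_setT : rho setT = 1%E.
Proof.
rewrite /rho /mscale [X in (_ * X)%E](measure_addE (sphere_measure (-1))).
rewrite [X in (_ * (X + _))%E]probability_setT.
rewrite [X in (_ * (_ + X))%E]probability_setT -EFinD -EFinM /=.
by rewrite -[1 + 1]/(2%:R) mulVf// pnatr_eq0.
Qed.

HB.instance Definition _ :=
  Measure_isProbability.Build _ _ R rho rho_setT.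

Definition two_spheres : set (borel_rV R n.+1) := sphere (-1) `|` sphere 1.

(* The minimum over the center c, as an infimum in the extended reals; when
   sigma lives on the unit sphere it is attained, at the rho-barycenter of A
   (anywhere if A is rho-null). *)
Definition part_error (A : set (borel_rV R n.+1)) : \bar R :=
  ereal_inf [set (\int[rho]_(x in A) (enorm (x - c) ^+ 2)%:E)%E
            | c in [set: 'rV[R]_n.+1]].

Definition mse (S1 : set (borel_rV R n.+1)) : \bar R :=
  (part_error S1 + part_error (two_spheres `\` S1))%E.

Definition cutoff_error (a : R) : \bar R :=
  mse [set x : 'rV[R]_n.+1 | two_spheres x /\ x 0 0 <= - a].

End two_spheres.

(* Main.v *)
Require Import Defs.
From HB Require Import structures.
From mathcomp Require Import all_boot all_order all_algebra.
From mathcomp Require Import all_classical all_reals all_analysis.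
From mathcomp Require Import measurable_realfun.
From mathcomp Require Import ring lra.

Set Implicit Arguments.
Unset Strict Implicit.
Unset Printing Implicit Defensive.
Import Order.TTheory GRing.Theory Num.Theory.
Import numFieldNormedType.Exports.

Local Open Scope classical_set_scope.
Local Open Scope ring_scope.

(** Why the theorem holds. Let sigma be the uniform measure on the unit circle,
    P = sigma (x_0 <= 1 - a) and M the integral of x_0 over that set. Since the
    integral of |x - c|^2 over a piece is a quadratic polynomial in c, each of
    the two minima is explicit, and the error of the cutoff a is 2 - G(a) with
    G(a) = (P - M)^2 / (P (2 - P)) (lemmas [part_errorE] and [cutoff_errorE]).
    At a = 0 one has P = 1 and M = 0, so G(0) = 1, and it has to be shown that G
    has a maximum over [0, 2) and that this maximum exceeds 1.

    The angular density of sigma is never computed; everything is drawn from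
    the invariance under reflections of the plane.

    Strictness. Let d = 1 - P be the mass of the cap x_0 > 1 - a. On the cap
    x_0 >= 1 - a, so P - M >= 1 - a d, while P (2 - P) = 1 - d^2. Hence
    G(a) > 1 as soon as d > 2 a. Caps of height a have mass of order sqrt a,
    so this holds for small a. Quantitatively, a cap is covered by two
    reflected copies of the cap with half its opening angle ([cap_halving]);
    starting from the full circle, four halvings give a cap of height 21/1000
    and mass at least 1/16 ([small_cap_mass], [gain_gt1]).

    Existence. All points of the circle have the same mass, hence mass zero
    ([point_null]), and a vertical line meets the circle in at most two points.
    So P is continuous in a, and so is M since |x_0| <= 1 on the circle. The
    quotient G may a priori blow up where P vanishes, but |M| <= P gives
    G <= 4 P / (2 - P) < 1 when P < 1/4. Replacing the factor P of the
    denominator by max (P, 1/4) therefore yields a function that is continuous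
    on [0, 2] and has the same maximum as G; it is attained neither at 0,
    where G = 1, nor at 2, where P = 0 ([exists_max_gain]). *)

(** * Borel measurability in R^n *)

Lemma continuous_measurable_borel (R : realType) n (f : 'rV[R]_n -> R) :
  continuous f -> measurable_fun [set: borel_rV R n] f.
Proof.
move=> cf; apply: (measurability _ (RGenOpens.measurableE R)).
move=> _ [_ [a [b ->] <-]]; rewrite setTI.
apply: (@sub_sigma_algebra _ setT (@open 'rV[R]_n)).
exact: (proj1 (continuousP _) cf _ (interval_open _ _)).
Qed.

Lemma continuous_measurable_borel_borel (R : realType) n m
    (f : 'rV[R]_n -> 'rV[R]_m) :
  continuous f -> measurable_fun [set: borel_rV R n] (f : _ -> borel_rV R m).
Proof.
move=> cf; apply: (@measurability _ _ (borel_rV R n) (borel_rV R m) setT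
  f (@open 'rV[R]_m)) => // _ [B oB <-]; rewrite setTI.
apply: (@sub_sigma_algebra _ setT (@open 'rV[R]_n)).
exact: (proj1 (continuousP _) cf).
Qed.

Lemma measurable_coord (R : realType) n (i : 'I_n) :
  measurable_fun [set: borel_rV R n] (fun x : 'rV[R]_n => x 0 i).
Proof.
apply: (@continuous_measurable_borel R n (fun x : 'rV[R]_n => x 0 i)).
exact: coord_continuous.
Qed.

Lemma continuous_mulmxr (R : realType) n (U : 'M[R]_n) :
  continuous (fun x : 'rV[R]_n => x *m U).
Proof.
move=> x; rewrite /continuous_at.
under eq_fun do rewrite mulmx_sum_row.
rewrite mulmx_sum_row; have FF := @nbhs_filter _ x.
apply: cvg_big => [|i _].
  exact: add_continuous.
by apply: cvgZr_tmp; exact: coord_continuous.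
Qed.

Lemma measurable_mulmxr (R : realType) n (U : 'M[R]_n) :
  measurable_fun [set: borel_rV R n]
    ((fun x : 'rV[R]_n => x *m U) : _ -> borel_rV R n).
Proof.
apply: (@continuous_measurable_borel_borel R n n (fun x => x *m U)).
exact: continuous_mulmxr.
Qed.

Lemma enorm_sqr (R : realType) n (x : 'rV[R]_n) :
  enorm x ^+ 2 = \sum_(i < n) x 0 i ^+ 2.
Proof. by rewrite /enorm sqr_sqrtr// sumr_ge0// => i _; rewrite sqr_ge0. Qed.

Lemma measurable_enorm_sqr (R : realType) n (c : 'rV[R]_n) :
  measurable_fun [set: borel_rV R n] (fun x : 'rV[R]_n => enorm (x - c) ^+ 2).
Proof.
under eq_fun do rewrite enorm_sqr.
apply: measurable_sum => i; apply: measurable_funX.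
under eq_fun do rewrite !mxE.
by apply: measurable_funB => //; exact: measurable_coord.
Qed.

Lemma sphereE (R : realType) n (a : R) :
  sphere a = [set x : 'rV[R]_n.+1 | enorm (x - a *: e1) ^+ 2 = 1].
Proof.
apply/seteqP; split=> [x|x] /=; first by move=> ->; rewrite expr1n.
by move=> /eqP; rewrite sqrp_eq1 ?sqrtr_ge0// => /eqP.
Qed.

Lemma measurable_sphere (R : realType) n (a : R) :
  measurable (sphere a : set (borel_rV R n.+1)).
Proof.
rewrite sphereE -[X in measurable X]setTI.
exact: (measurable_enorm_sqr (a *: e1) measurableT (measurable_set1 1)).
Qed.

Lemma enorm_sqr_subE (R : realType) (x c : 'rV[R]_2) :
  enorm (x - c) ^+ 2 = (x 0 0 - c 0 0) ^+ 2 + (x 0 1 - c 0 1) ^+ 2.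
Proof.
rewrite enorm_sqr big_ord_recl big_ord1 !mxE.
by rewrite (_ : lift ord0 ord0 = 1)//; exact/val_inj.
Qed.

Lemma scale_e1E (R : realType) (a : R) :
  ((a *: e1 : 'rV[R]_2) 0 0 = a) * ((a *: e1 : 'rV[R]_2) 0 1 = 0).
Proof. by rewrite !mxE/= mulr1 mulr0. Qed.

Lemma in_sphere (R : realType) (a : R) (x : 'rV[R]_2) :
  sphere a x <-> (x 0 0 - a) ^+ 2 + x 0 1 ^+ 2 = 1.
Proof. by rewrite sphereE/= enorm_sqr_subE !scale_e1E subr0. Qed.

Lemma circleP (R : realType) (x : 'rV[R]_2) :
  sphere 0 x <-> x 0 0 ^+ 2 + x 0 1 ^+ 2 = 1.
Proof. by rewrite in_sphere subr0. Qed.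

(** * Reflections of the circle *)

(** The reflection that exchanges (1, 0) and (c, s) when c^2 + s^2 = 1. This
    one family contains the symmetries about both axes and is transitive on
    the circle, so no other isometries of the plane are used below. *)
Definition refl_mx (R : realType) (c s : R) : 'M[R]_2 :=
  \matrix_(i, j) if i == 0 then (if j == 0 then c else s)
                 else (if j == 0 then s else - c).

Definition refl (R : realType) (c s : R) (x : borel_rV R 2) : borel_rV R 2 :=
  (x : 'rV[R]_2) *m refl_mx c s.

Lemma ord2_sum (R : realType) (F : 'I_2 -> R) : \sum_(i < 2) F i = F 0 + F 1.
Proof.
rewrite big_ord_recl big_ord1; congr (_ + F _); exact/val_inj.
Qed.

Lemma refl_coord0 (R : realType) (c s : R) (x : 'rV[R]_2) :
  (refl c s x : 'rV[R]_2) 0 0 = x 0 0 * c + x 0 1 * s.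
Proof. by rewrite mxE ord2_sum !mxE. Qed.

Lemma refl_coord1 (R : realType) (c s : R) (x : 'rV[R]_2) :
  (refl c s x : 'rV[R]_2) 0 1 = x 0 0 * s - x 0 1 * c.
Proof. by rewrite mxE ord2_sum !mxE/= mulrN. Qed.

Lemma rV2P (R : realType) (x y : 'rV[R]_2) :
  x 0 0 = y 0 0 -> x 0 1 = y 0 1 -> x = y.
Proof.
move=> h0 h1; apply/rowP => i; have [->//|] := eqVneq i 0.
case: i => -[//|[|//]] ip _.
by rewrite (_ : Ordinal ip = 1)//; exact/val_inj.
Qed.

Lemma refl_mx_orthogonal (R : realType) (c s : R) : c ^+ 2 + s ^+ 2 = 1 ->
  refl_mx c s *m (refl_mx c s)^T = 1%:M.
Proof.
move=> cs; apply/row_matrixP => i; apply: rV2P;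
  rewrite !mxE ord2_sum !mxE/=; case: i => -[|[|//]] i /=; lra.
Qed.

Lemma refl_circle (R : realType) (c s : R) (x : 'rV[R]_2) :
  c ^+ 2 + s ^+ 2 = 1 -> sphere 0 (refl c s x : 'rV[R]_2) <-> sphere 0 x.
Proof.
move=> cs; rewrite !circleP refl_coord0 refl_coord1.
rewrite (_ : (x 0 0 * c + x 0 1 * s) ^+ 2 + _ =
  (x 0 0 ^+ 2 + x 0 1 ^+ 2) * (c ^+ 2 + s ^+ 2)); last by ring.
by rewrite cs mulr1.
Qed.

Lemma measurable_refl (R : realType) (c s : R) :
  measurable_fun [set: borel_rV R 2] (refl c s).
Proof. exact: measurable_mulmxr. Qed.

Lemma circle_coord_le1 (R : realType) (x : 'rV[R]_2) i :
  sphere 0 x -> `|x 0 i| <= 1.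
Proof.
rewrite circleP => x1; rewrite -(@expr_le1 _ 2)// -normrX ger0_norm ?sqr_ge0//.
have [->|] := eqVneq i 0; first by rewrite -x1 lerDl sqr_ge0.
case: i => -[//|[|//]] ip _.
by rewrite (_ : Ordinal ip = 1) -?x1 ?lerDr ?sqr_ge0//; exact/val_inj.
Qed.

Arguments circle_coord_le1 {R x} i _.

(** * Mass and first moments of the uniform measure *)

Definition mass (R : realType) (sigma : probability (borel_rV R 2) R)
  (B : set (borel_rV R 2)) : R := fine (sigma B).

(** The domain is cut down to the circle, where the coordinates are bounded, so
    that the integral is finite for every measurable B. *)
Definition moment (R : realType) (sigma : probability (borel_rV R 2) R)
    (i : 'I_2) (B : set (borel_rV R 2)) : R :=
  \int[sigma]_(x in B `&` sphere 0) (x : 'rV[R]_2) 0 i.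

Section uniform.
Context (R : realType) (sigma : probability (borel_rV R 2) R).
Context (sigmaP : is_uniform_on_sphere sigma).
Local Notation V := (borel_rV R 2).
Local Notation circle := (sphere 0 : set V).

Local Notation mass := (mass sigma).
Local Notation moment := (moment sigma).
Implicit Types A B : set V.

Lemma measurable_circle : measurable circle.
Proof. exact: measurable_sphere. Qed.

Lemma massE B : measurable B -> sigma B = (mass B)%:E.
Proof. by move=> mB; rewrite fineK// fin_num_measure. Qed.

Lemma mass_ge0 B : 0 <= mass B. Proof. exact: fine_ge0. Qed.

Lemma le_mass A B : measurable A -> measurable B -> A `<=` B ->
  mass A <= mass B.
Proof.
by move=> mA mB AB; rewrite -lee_fin -!massE// le_measure// inE.
Qed.

Lemma massC B : measurable B -> mass (~` B) = 1 - mass B.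
Proof.
move=> mB; apply: EFin_inj; rewrite EFinB -!massE//; last exact: measurableC.
exact: probability_setC.
Qed.

Lemma mass_subadditive A B : measurable A -> measurable B ->
  mass (A `|` B) <= mass A + mass B.
Proof.
move=> mA mB; rewrite -lee_fin EFinD -!massE//; last exact: measurableU.
exact: measureU2.
Qed.

Lemma mass_circle B : measurable B -> sigma (B `&` circle) = sigma B.
Proof.
move=> mB; have mT := measurable_circle.
rewrite [in RHS](measureDI _ mB mT) [X in _ = (X + _)%E](_ : _ = 0%E).
  by rewrite add0e.
apply: (subset_measure0 _ (measurableC mT)).
- exact: measurableD.
- by move=> x [].
- by apply: (etrans (probability_setC sigma mT)); rewrite sigmaP.1 subee.
Qed.

Lemma refl_invariant c s B : c ^+ 2 + s ^+ 2 = 1 -> measurable B ->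
  sigma (refl c s @^-1` B) = sigma B.
Proof. by move=> cs mB; exact: sigmaP.2 (refl_mx_orthogonal cs) _ mB. Qed.

Lemma integrable_coord i B : measurable B ->
  sigma.-integrable (B `&` circle) (fun x : V => ((x : 'rV[R]_2) 0 i)%:E).
Proof.
move=> mB; apply: measurable_bounded_integrable.
- exact: measurableI measurable_circle.
- by rewrite (le_lt_trans (probability_le1 _ _))// ?ltry//;
    apply: measurableI => //; exact: measurable_sphere.
- by apply: measurable_funTS; exact: measurable_coord.
- exists 1; split; first exact: num_real.
  by move=> y y1 x [_ /(circle_coord_le1 i) h]; exact: le_trans h (ltW y1).
Qed.

(** The image of sigma under the reflection is sigma, and the circle is mapped to
    itself: this is the change of variables along the reflection. *)
Lemma moment_refl c s i B : c ^+ 2 + s ^+ 2 = 1 -> measurable B ->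
  moment i B = \int[sigma]_(x in (refl c s @^-1` B) `&` circle)
                 (refl c s x : 'rV[R]_2) 0 i.
Proof.
move=> cs mB; have mT := measurable_circle.
have mBT : measurable (B `&` circle) by exact: measurableI.
have pre : refl c s @^-1` (B `&` circle) = refl c s @^-1` B `&` circle.
  by apply/seteqP; split => x [Bx /(refl_circle _ cs) Tx].
rewrite /moment /Rintegral -pre; congr fine.
rewrite -(integral_pushforward (measurable_refl c s)
  (f := fun x : V => ((x : 'rV[R]_2) 0 i)%:E))//.
- apply: eq_measure_integral => [|mr A mA _]; first exact: measurable_refl.
  exact: (esym (refl_invariant cs mA)).
- by apply/measurable_EFinP; exact: measurable_coord.
- rewrite pre; apply: measurable_bounded_integrable.
  + apply: measurableI => //; rewrite -[X in measurable X]setTI.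
    exact: measurable_refl.
  + rewrite (le_lt_trans (probability_le1 _ _))// ?ltry//.
    apply: measurableI => //; rewrite -[X in measurable X]setTI.
    exact: measurable_refl.
  + apply: measurable_funTS.
    apply: (@measurableT_comp _ _ _ _ _ _ (fun x : V => (x : 'rV[R]_2) 0 i)).
      exact: measurable_coord.
    exact: measurable_refl.
  + exists 1; split; first exact: num_real.
    move=> y y1 x [_ /(refl_circle _ cs)/(circle_coord_le1 i) h].
    exact: le_trans h (ltW y1).
Qed.

(** The reflection x_1 -> - x_1 changes the sign of the integrand. *)
Lemma moment1_eq0 B : measurable B ->
  (forall x : 'rV[R]_2, B (refl 1 0 x) <-> B x) -> moment 1 B = 0.
Proof.
move=> mB symB; have cs : (1 : R) ^+ 2 + 0 ^+ 2 = 1 by lra.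
have : moment 1 B = - moment 1 B; last by lra.
rewrite {1}(moment_refl _ cs mB).
rewrite (_ : refl 1 0 @^-1` B = B); last by apply/seteqP; split => x /symB.
rewrite -mulN1r /moment -RintegralZl//.
- by apply: eq_Rintegral => x _; rewrite refl_coord1 mulr0 mulr1 add0r mulN1r.
- exact: measurableI measurable_circle.
- exact: integrable_coord.
Qed.

Lemma moment0_setT : moment 0 setT = 0.
Proof.
have cs : (- 1 : R) ^+ 2 + 0 ^+ 2 = 1 by lra.
have : moment 0 setT = - moment 0 setT; last by lra.
rewrite {1}(moment_refl _ cs measurableT) preimage_setT.
rewrite -[RHS]mulN1r /moment -RintegralZl//.
- by apply: eq_Rintegral => x _; rewrite refl_coord0 mulr0 addr0 mulrC.
- exact: measurableI measurable_circle.
- exact: integrable_coord.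
Qed.

Lemma momentU i A B : measurable A -> measurable B -> [disjoint A & B] ->
  moment i (A `|` B) = moment i A + moment i B.
Proof.
move=> mA mB AB; have mT := measurable_circle.
rewrite /moment setIUl Rintegral_setU//.
- exact: measurableI.
- exact: measurableI.
- by rewrite -setIUl; apply: integrable_coord; exact: measurableU.
- apply/disj_setPS => x [[Ax _] [Bx _]].
  by move/disj_setPS : AB => /(_ x); exact.
Qed.

Lemma momentC B : measurable B -> moment 0 (~` B) = - moment 0 B.
Proof.
move=> mB; apply/eqP; rewrite -addr_eq0; apply/eqP.
rewrite addrC -momentU ?setUv ?moment0_setT//; first exact: measurableC.
by apply/disj_setPS => x [].
Qed.

Lemma mass_cst B (r : R) : measurable B ->
  \int[sigma]_(x in B `&` circle) r = r * mass B.
Proof.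
move=> mB; rewrite Rintegral_cst; last first.
  exact: measurableI measurable_circle.
by congr (r * fine _); exact: mass_circle.
Qed.

Lemma integrable_circle_cst B (r : R) : measurable B ->
  sigma.-integrable (B `&` circle) (EFin \o (cst r)).
Proof.
move=> mB; apply: finite_measure_integrable_cst.
exact: measurableI measurable_circle.
Qed.

Lemma ge_moment0 B c : measurable B ->
  (forall x : 'rV[R]_2, B x -> sphere 0 x -> c <= x 0 0) ->
  c * mass B <= moment 0 B.
Proof.
move=> mB cB; rewrite -mass_cst//; apply: le_Rintegral.
- exact: measurableI measurable_circle.
- exact: integrable_circle_cst.
- exact: integrable_coord.
- by move=> x [Bx Tx]; exact: cB.
Qed.

Lemma moment0_le_mass B : measurable B -> `|moment 0 B| <= mass B.
Proof.
move=> mB; rewrite ler_norml; apply/andP; split.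
  rewrite -mulN1r; apply: ge_moment0 => // x _ /(circle_coord_le1 0).
  by rewrite ler_norml => /andP[].
rewrite -[leRHS]mul1r -mass_cst//; apply: le_Rintegral.
- exact: measurableI measurable_circle.
- exact: integrable_coord.
- exact: integrable_circle_cst.
- by move=> x [Bx /(circle_coord_le1 0)]; rewrite ler_norml => /andP[].
Qed.

End uniform.

(** * Absence of atoms and distribution of the first coordinate *)

(** A named copy of the first coordinate, to carry the random variable structure
    from which its distribution function is obtained. *)
Definition first_coord (R : realType) (x : borel_rV R 2) : R :=
  (x : 'rV[R]_2) 0 0.

HB.instance Definition _ (R : realType) :=
  isMeasurableFun.Build _ _ (borel_rV R 2) R (@first_coord R)
    (@measurable_coord R 2 0).

Definition low (R : realType) (t : R) : set (borel_rV R 2) :=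
  [set x | first_coord x <= t].

Definition high (R : realType) (t : R) : set (borel_rV R 2) :=
  [set x | t <= first_coord x].

Definition vec2 (R : realType) (c s : R) : 'rV[R]_2 :=
  \row_j if j == 0 then c else s.

Lemma vec2_coord0 (R : realType) (c s : R) : vec2 c s 0 0 = c.
Proof. by rewrite mxE. Qed.

Lemma vec2_coord1 (R : realType) (c s : R) : vec2 c s 0 1 = s.
Proof. by rewrite mxE. Qed.

Lemma measurable_low (R : realType) (t : R) : measurable (low t).
Proof.
rewrite (_ : low t = @first_coord R @^-1` `]-oo, t]); first exact: measurable_funPTI.
by apply/seteqP; split => x; rewrite /= in_itv.
Qed.

Lemma measurable_high (R : realType) (t : R) : measurable (high t).
Proof.
rewrite (_ : high t = @first_coord R @^-1` `[t, +oo[); first exact: measurable_funPTI.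
by apply/seteqP; split => x; rewrite /= in_itv /= andbT.
Qed.

Lemma measurable_point (R : realType) (p : 'rV[R]_2) :
  measurable ([set p] : set (borel_rV R 2)).
Proof.
rewrite (_ : [set p] = (@first_coord R @^-1` [set p 0 0]) `&`
  ((fun x : borel_rV R 2 => (x : 'rV[R]_2) 0 1) @^-1` [set p 0 1])).
  apply: measurableI; first exact: measurable_funPTI.
  rewrite -[X in measurable X]setTI.
  by apply: (@measurable_coord R 2 1).
by apply/seteqP; split => [x ->//|x [/= x0 x1]]; exact: rV2P.
Qed.

Section profile.
Context (R : realType) (sigma : probability (borel_rV R 2) R).
Context (sigmaP : is_uniform_on_sphere sigma).
Local Notation V := (borel_rV R 2).
Local Notation mass := (mass sigma).
Local Notation moment := (moment sigma).
Implicit Types A B : set V.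

(** The reflection that exchanges (1, 0) and (c, s) carries one point mass to the
    other. *)
Lemma point_mass_const (c s : R) : c ^+ 2 + s ^+ 2 = 1 ->
  sigma [set vec2 c s] = sigma [set vec2 1 0].
Proof.
move=> cs; rewrite -(refl_invariant sigmaP cs (measurable_point (vec2 1 0))).
congr (sigma _); apply/seteqP; split => [x ->|x /= xp] /=.
  by apply: rV2P; rewrite ?refl_coord0 ?refl_coord1 !mxE/=; lra.
have := refl_coord0 c s x; have := refl_coord1 c s x.
rewrite xp vec2_coord0 vec2_coord1 => h1 h0.
apply: rV2P; rewrite ?vec2_coord0 ?vec2_coord1.
- transitivity (x 0 0 * (c ^+ 2 + s ^+ 2)); first by rewrite cs mulr1.
  transitivity (c * (x 0 0 * c + x 0 1 * s) + s * (x 0 0 * s - x 0 1 * c)).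
    by ring.
  by rewrite -h1 -h0; ring.
- transitivity (x 0 1 * (c ^+ 2 + s ^+ 2)); first by rewrite cs mulr1.
  transitivity (s * (x 0 0 * c + x 0 1 * s) - c * (x 0 0 * s - x 0 1 * c)).
    by ring.
  by rewrite -h1 -h0; ring.
Qed.

(** If the common mass of the points were positive, every number of [0, 1], being
    the first coordinate of a point of the circle, would be an atom of the
    distribution of x_0; but a distribution has countably many atoms. *)
Lemma point_null (c s : R) : c ^+ 2 + s ^+ 2 = 1 -> sigma [set vec2 c s] = 0%E.
Proof.
move=> cs; rewrite (point_mass_const cs); apply/eqP; rewrite -measure_le0 leNgt.
apply/negP => pos.
have : countable (`[0, 1]%classic : set R).
  apply: (sub_countable _ (pmf_gt0_countable (@first_coord R : {RV sigma >-> R}))).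
  apply: subset_card_le => r /=; rewrite in_itv/= => /andP[r0 r1].
  have rs : r ^+ 2 + (Num.sqrt (1 - r ^+ 2)) ^+ 2 = 1.
    by rewrite sqr_sqrtr ?subr_ge0 ?expr_le1// addrC subrK.
  have mr : measurable (@first_coord R @^-1` [set r]) by exact: measurable_funPTI.
  rewrite /pmf -lte_fin fineK ?fin_num_measure//.
  have posr : (0 < sigma [set vec2 r (Num.sqrt (1 - r ^+ 2))])%E.
    by rewrite (point_mass_const rs).
  apply: (lt_le_trans posr).
  apply: le_measure; rewrite ?inE//; first exact: measurable_point.
  by move=> x -> /=; rewrite /first_coord vec2_coord0.
move=> /countable_lebesgue_measure0; rewrite lebesgue_measure_itv/= lte01.
by rewrite -EFinB subr0 => -[] /eqP; rewrite oner_eq0.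
Qed.

(** On the circle, the line x_0 = t consists of the points with
    x_1 = sqrt (1 - t^2) or x_1 = - sqrt (1 - t^2), so at most of two. *)
Lemma level_null (t : R) : sigma (@first_coord R @^-1` [set t]) = 0%E.
Proof.
have mt : measurable (@first_coord R @^-1` [set t]) by exact: measurable_funPTI.
have mT := @measurable_circle R.
rewrite -mass_circle//.
pose s := Num.sqrt (1 - t ^+ 2).
have [t1|t1] := leP (t ^+ 2) 1; last first.
  rewrite (_ : _ `&` _ = set0) ?measure0//; apply/seteqP; split => // x.
  move=> [/= xt /circleP]; rewrite -[x 0 0]/(first_coord x) xt => h.
  by have := sqr_ge0 (x 0 1); lra.
have ts : t ^+ 2 + s ^+ 2 = 1 by rewrite sqr_sqrtr ?subr_ge0// addrC subrK.
have tNs : t ^+ 2 + (- s) ^+ 2 = 1 by rewrite sqrrN.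
have mp1 := measurable_point (vec2 t s).
have mp2 := measurable_point (vec2 t (- s)).
apply: (@subset_measure0 _ _ _ sigma _ ([set vec2 t s] `|` [set vec2 t (-s)])).
- exact: measurableI.
- exact: measurableU.
- move=> x [/= xt /circleP]; rewrite -[x 0 0]/(first_coord x) xt => h.
  have /eqP : x 0 1 ^+ 2 = s ^+ 2 by lra.
  rewrite eqf_sqr => /orP[] /eqP xs; [left|right];
    by apply: rV2P; rewrite ?vec2_coord0 ?vec2_coord1.
- by apply: (etrans (measureU0 mp1 mp2 _)); exact: point_null.
Qed.

Lemma mass_highE t : mass (high t) = 1 - mass (low t).
Proof.
rewrite -massC; last exact: measurable_low.
congr fine; rewrite (_ : high t = ~` low t `|` @first_coord R @^-1` [set t]).
  apply: measureU0; last exact: level_null.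
    by apply: measurableC; exact: measurable_low.
  exact: measurable_funPTI.
apply/seteqP; split => x; rewrite /high /low/=.
  rewrite le_eqVlt => /predU1P[->|]; first by right.
  by rewrite ltNge => /negP; left.
by case=> [/negP|->//]; rewrite -ltNge => /ltW.
Qed.

Lemma mass_high_low t : mass (high t) = mass (low (- t)).
Proof.
have cs : (- 1 : R) ^+ 2 + 0 ^+ 2 = 1 by lra.
congr fine; rewrite -(refl_invariant sigmaP cs (measurable_low (- t))).
congr (sigma _); apply/seteqP; split => x;
  rewrite /high /low /= /first_coord refl_coord0 mulr0 addr0; lra.
Qed.

Lemma mass_low_symmetric t : mass (low t) = 1 - mass (low (- t)).
Proof. by rewrite -mass_highE mass_high_low opprK. Qed.

(** A distribution function is right-continuous. Without atoms, the symmetry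
    x_0 -> - x_0 exchanges its values at t and - t up to complement, which turns
    right continuity at - t into left continuity at t. *)
Lemma mass_low_continuous : continuous (fun t => mass (low t)).
Proof.
have cdfE : cdf (@first_coord R : {RV sigma >-> R}) = fun t => (mass (low t))%:E.
  apply/funext => t; rewrite -massE; last exact: measurable_low.
  by congr (sigma _); apply/seteqP; split => x; rewrite /= in_itv.
have rc t : mass (low u) @[u --> t^'+] --> mass (low t).
  have := @cdf_right_continuous _ _ _ sigma (@first_coord R) t.
  rewrite cdfE.
  exact: fine_cvg.
move=> t; apply/left_right_continuousP; split; last exact: rc.
apply/cvg_at_leftNP; rewrite mass_low_symmetric.
have -> : (fun u => mass (low u)) \o -%R = fun u => 1 - mass (low u).
  by apply/funext => u; rewrite /= mass_low_symmetric opprK.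
by apply: cvgB; [exact: cvg_cst|exact: rc].
Qed.

(** The two sets differ by a strip, on which |x_0| <= 1. *)
Lemma moment_low_lipschitz s t :
  `|moment 0 (low s) - moment 0 (low t)| <= `|mass (low s) - mass (low t)|.
Proof.
wlog st : s t / s <= t.
  move=> h; have [/h//|/ltW/h] := leP s t.
  by rewrite distrC [leRHS]distrC.
have mst : measurable (low t `\` low s).
  by apply: measurableD; exact: measurable_low.
have sub : low s `<=` low t by move=> x /= /le_trans; exact.
have tE : low t = low s `|` (low t `\` low s) by rewrite setDUK.
have dj : [disjoint low s & low t `\` low s] by apply/disj_setPS => x [xs []].
rewrite [in moment 0 (low t)]tE momentU//; last exact: measurable_low.
rewrite (_ : mass (low t) = mass (low s) + mass (low t `\` low s)); last first.
  apply: EFin_inj; rewrite EFinD -!massE//; try exact: measurable_low.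
  by rewrite [in LHS]tE measureU//; [exact: measurable_low|exact/disj_set2P].
rewrite !opprD !addrA !subrr !sub0r !normrN.
rewrite [leRHS]ger0_norm ?mass_ge0//; exact: moment0_le_mass.
Qed.

Lemma moment_low_continuous : continuous (fun t => moment 0 (low t)).
Proof.
move=> t; apply/cvgrPdist_lt => e e0.
have /cvgrPdist_lt/(_ e e0) := @mass_low_continuous t.
apply: filterS => u; apply: le_lt_trans; exact: moment_low_lipschitz.
Qed.

(** * Masses of small caps *)

(** With c = cos u and t = cos (2 u) the hypothesis on c is an equality: a cap of
    half-angle 2 u is covered by the images of the cap of half-angle u under the
    reflections that exchange (1, 0) with the points of angle u and - u. The
    inequality leaves room for rational values of c. *)
Lemma cap_halving c t : 0 <= c <= 1 -> 2 * c ^+ 2 <= 1 + t ->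
  mass (high t) <= 2 * mass (high c).
Proof.
move=> /andP[c0 c1] ct; pose s := Num.sqrt (1 - c ^+ 2).
have s0 : 0 <= s by exact: sqrtr_ge0.
have cs : c ^+ 2 + s ^+ 2 = 1.
  by rewrite sqr_sqrtr ?subr_ge0 ?expr_le1// addrC subrK.
have cNs : c ^+ 2 + (- s) ^+ 2 = 1 by rewrite sqrrN.
have mc := measurable_high c.
have mref s' : measurable (refl c s' @^-1` high c).
  rewrite -[X in measurable X]setTI; exact: measurable_refl.
have refm s' : c ^+ 2 + s' ^+ 2 = 1 ->
    mass (refl c s' @^-1` high c) = mass (high c).
  by move=> cs'; congr fine; exact: refl_invariant.
have -> : mass (high t) = mass (high t `&` sphere 0).
  by congr fine; rewrite mass_circle//; exact: measurable_high.
have -> : 2 * mass (high c) =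
    mass (refl c s @^-1` high c) + mass (refl c (- s) @^-1` high c).
  by rewrite !refm// mulr_natl mulr2n.
apply: le_trans (mass_subadditive _ _ _) => //.
apply: le_mass.
- apply: measurableI; [exact: measurable_high|exact: measurable_circle].
- exact: measurableU.
move=> x [/= tx /circleP x1]; rewrite /high /= /first_coord in tx *.
(* By [key] one of c x_0 + s x_1 and c x_0 - s x_1 is at least c; squared, it
   says (1 - c^2) (1 + x_0) >= c^2 (1 - x_0), that is 1 + x_0 >= 2 c^2. *)
have key : c * (1 - x 0 0) <= s * `|x 0 1|.
  have x01 : x 0 0 <= 1.
    by have := sqr_ge0 (x 0 1); nra.
  rewrite -(@ler_pXn2r _ 2)// ?nnegrE ?mulr_ge0 ?subr_ge0//.
  rewrite !exprMn -normrX ger0_norm ?sqr_ge0//.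
  rewrite (_ : s ^+ 2 = 1 - c ^+ 2); last by lra.
  rewrite (_ : x 0 1 ^+ 2 = (1 - x 0 0) * (1 + x 0 0)); last by lra.
  rewrite -subr_ge0 (_ : _ - _ = (1 - x 0 0) * (1 + x 0 0 - 2 * c ^+ 2)).
    by apply: mulr_ge0; lra.
  by ring.
have [x10|/ltW x10] := leP 0 (x 0 1); [left|right]; rewrite refl_coord0;
  move: key; [rewrite ger0_norm//|rewrite ler0_norm//]; lra.
Qed.

Lemma half_le_mass_high0 : 1 / 2 <= mass (high 0).
Proof.
have : mass (high (-1)) <= 2 * mass (high 0) by apply: cap_halving; lra.
suff -> : mass (high (-1)) = 1 by lra.
rewrite (_ : mass _ = mass (sphere 0)); first by rewrite /mass sigmaP.1.
congr fine; rewrite -[LHS]mass_circle//; last exact: measurable_high.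
congr (sigma _); apply/seteqP; split => x; first by case.
move=> Tx; split => //; have := circle_coord_le1 0 Tx.
by rewrite ler_norml => /andP[].
Qed.

(** The numbers 0, 7/10, 92/100, 979/1000 are rational lower approximations of
    the cosines of pi/2, pi/4, pi/8, pi/16, close enough for the height
    1 - 979/1000 of the last cap to stay below half its mass. *)
Lemma small_cap_mass : 1 / 16 <= mass (high (979 / 1000)).
Proof.
have h0 := half_le_mass_high0.
have h1 : mass (high 0) <= 2 * mass (high (7 / 10)).
  by apply: cap_halving; lra.
have h2 : mass (high (7 / 10)) <= 2 * mass (high (92 / 100)).
  by apply: cap_halving; lra.
have h3 : mass (high (92 / 100)) <= 2 * mass (high (979 / 1000)).
  by apply: cap_halving; lra.
lra.
Qed.

End profile.

(** * The error of a cutoff *)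

(** The minimum is attained at (l / k, 0). For k = 0 the division by zero gives 0,
    which is the right value because the polynomial is then constant. *)
Lemma ereal_inf_quadratic (R : realType) (k l r : R) :
  0 <= k -> (k = 0 -> l = 0) ->
  ereal_inf [set (k * (c 0 0 ^+ 2 + c 0 1 ^+ 2) - 2 * l * c 0 0 + r)%:E
            | c in [set: 'rV[R]_2]] = (r - l ^+ 2 / k)%:E.
Proof.
move=> k0 l0; apply/eqP; rewrite eq_le; apply/andP; split.
  apply: ereal_inf_lbound; exists (vec2 (l / k) 0) => //.
  rewrite vec2_coord0 vec2_coord1; congr EFin.
  have [/l0 ->|kN0] := eqVneq k 0; first by ring.
  by field.
apply: le_ereal_inf_tmp => _ [c _ <-]; rewrite lee_fin.
have [kE|kN0] := eqVneq k 0; first by rewrite (l0 kE) kE; lra.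
have kp : 0 < k by rewrite lt_def kN0.
rewrite -subr_ge0 (_ : _ - _ =
  k * ((c 0 0 - l / k) ^+ 2 + c 0 1 ^+ 2)); last by field.
by rewrite mulr_ge0// addr_ge0 ?sqr_ge0.
Qed.

Section error.
Context (R : realType) (sigma : probability (borel_rV R 2) R).
Context (sigmaP : is_uniform_on_sphere sigma).
Local Notation V := (borel_rV R 2).
Local Notation mass := (mass sigma).
Local Notation moment := (moment sigma).
Local Notation two_spheres := (@two_spheres R 1).
Implicit Types A B : set V.

Lemma shift_coord0 a (x : V) :
  (shift_e1 a x : 'rV[R]_2) 0 0 = (x : 'rV[R]_2) 0 0 + a.
Proof. by rewrite mxE scale_e1E. Qed.

Lemma shift_coord1 a (x : V) :
  (shift_e1 a x : 'rV[R]_2) 0 1 = (x : 'rV[R]_2) 0 1.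
Proof. by rewrite mxE scale_e1E addr0. Qed.

Lemma integral_rho A (g : V -> \bar R) : measurable A ->
  measurable_fun setT g -> (forall x, 0 <= g x)%E ->
  (\int[rho sigma]_(x in A) g x = (2^-1)%:E *
   (\int[sigma]_(x in shift_e1 (-1) @^-1` A) g (shift_e1 (-1) x) +
    \int[sigma]_(x in shift_e1 1 @^-1` A) g (shift_e1 1 x)))%E.
Proof.
move=> mA mg g0; have mgA : measurable_fun A g by exact: measurable_funTS.
rewrite /rho ge0_integral_mscale//; congr (_ * _)%E.
rewrite ge0_integral_measure_add//; congr (_ + _)%E.
- rewrite ge0_integral_pushforward//; exact: measurable_shift_e1.
- rewrite ge0_integral_pushforward//; exact: measurable_shift_e1.
Qed.

Lemma integral_circle B (g : V -> \bar R) : measurable B ->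
  measurable_fun setT g -> (forall x, 0 <= g x)%E ->
  (\int[sigma]_(x in B) g x = \int[sigma]_(x in B `&` sphere 0) g x)%E.
Proof.
move=> mB mg g0; have mT := @measurable_circle R.
rewrite (ge0_negligible_integral (measurableC mT) mB)//.
- by rewrite setDE setCK.
- exact: measurable_funTS.
- by apply: (etrans (probability_setC sigma mT)); rewrite sigmaP.1 subee.
Qed.

(** On the circle |x + a e_1 - c|^2 is affine in x, since |x|^2 = 1. *)
Lemma integral_shifted_sq_dist B a (c : 'rV[R]_2) : measurable B ->
  (\int[sigma]_(x in B) (enorm ((shift_e1 a x : 'rV[R]_2) - c) ^+ 2)%:E =
  ((1 + (a - c 0 0) ^+ 2 + c 0 1 ^+ 2) * mass B +
    2 * (a - c 0 0) * moment 0 B + (- 2 * c 0 1) * moment 1 B)%:E)%E.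
Proof.
move=> mB; have mT := @measurable_circle R.
have mBT : measurable (B `&` sphere 0) by exact: measurableI.
rewrite integral_circle//; last 2 first.
- apply/measurable_EFinP.
  apply: (@measurableT_comp _ _ _ _ _ _
    (fun x : V => enorm ((x : 'rV[R]_2) - c) ^+ 2)).
    exact: measurable_enorm_sqr.
  exact: measurable_shift_e1.
- by move=> x; rewrite lee_fin sqr_ge0.
rewrite (eq_integral (fun x : V => (1 + (a - c 0 0) ^+ 2 + c 0 1 ^+ 2 +
    2 * (a - c 0 0) * (x : 'rV[R]_2) 0 0 +
    (- 2 * c 0 1) * (x : 'rV[R]_2) 0 1)%:E)); last first.
  move=> x /set_mem [_ /circleP x1]; congr EFin.
  by rewrite enorm_sqr_subE shift_coord0 shift_coord1; lra.
have ic i k : sigma.-integrable (B `&` sphere 0)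
    (EFin \o (fun x : V => k * (x : 'rV[R]_2) 0 i)).
  exact: (integrableZl mBT k (integrable_coord sigma i mB)).
have i0 k := integrable_circle_cst sigma k mB.
have i1 k k' : sigma.-integrable (B `&` sphere 0)
    (EFin \o (fun x : V => k + k' * (x : 'rV[R]_2) 0 0)).
  exact: (integrableD mBT (i0 k) (ic 0 k')).
rewrite -[LHS]fineK; last first.
  apply: integrable_fin_num => //.
  exact: (integrableD mBT (i1 _ _) (ic 1 _)).
congr EFin; rewrite -/(Rintegral _ _ _).
rewrite (RintegralD mBT (i1 _ _) (ic 1 _)) (RintegralD mBT (i0 _) (ic 0 _)).
congr (_ + _ + _); first exact: mass_cst.
- exact: (RintegralZl _ mBT (integrable_coord sigma 0 mB)).
- exact: (RintegralZl _ mBT (integrable_coord sigma 1 mB)).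
Qed.

(** The data p, m (on the left circle) and q, m' (on the right one) are masses and
    first moments of A, each taken after translating the circle to the origin.
    The vanishing of the vertical moments puts the barycenter on the axis. *)
Lemma part_errorE A (p m q m' : R) : measurable A ->
  mass (shift_e1 (-1) @^-1` A) = p -> moment 0 (shift_e1 (-1) @^-1` A) = m ->
  moment 1 (shift_e1 (-1) @^-1` A) = 0 ->
  mass (shift_e1 1 @^-1` A) = q -> moment 0 (shift_e1 1 @^-1` A) = m' ->
  moment 1 (shift_e1 1 @^-1` A) = 0 ->
  part_error sigma A =
    (p + q - m + m' - (q + m' + m - p) ^+ 2 / (2 * (p + q)))%:E.
Proof.
move=> mA pE mE m1 qE m'E m'1.
have ms a : measurable (shift_e1 a @^-1` A : set V).
  by rewrite -[X in measurable X]setTI; exact: measurable_shift_e1.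
have p0 : 0 <= p by rewrite -pE mass_ge0.
have q0 : 0 <= q by rewrite -qE mass_ge0.
have mp : `|m| <= p by rewrite -mE -pE; exact: moment0_le_mass.
have m'q : `|m'| <= q by rewrite -m'E -qE; exact: moment0_le_mass.
transitivity (ereal_inf [set ((p + q) / 2 * (c 0 0 ^+ 2 + c 0 1 ^+ 2) -
    2 * ((q + m' + m - p) / 2) * c 0 0 + (p + q - m + m'))%:E
            | c in [set: 'rV[R]_2]]).
  rewrite /part_error; congr ereal_inf; apply: eq_imagel => c _.
  rewrite integral_rho//; last 2 first.
  - by apply/measurable_EFinP; exact: measurable_enorm_sqr.
  - by move=> x; rewrite lee_fin sqr_ge0.
  rewrite !integral_shifted_sq_dist// pE mE m1 qE m'E m'1 -EFinD -EFinM.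
  by congr EFin; field.
rewrite ereal_inf_quadratic; last 2 first.
- by rewrite divr_ge0// addr_ge0.
- move=> /eqP; rewrite mulf_eq0 invr_eq0 pnatr_eq0 orbF => /eqP pq.
  have pE0 : p = 0 by lra.
  have qE0 : q = 0 by lra.
  move: mp m'q; rewrite pE0 qE0 !normr_le0 => /eqP -> /eqP ->; lra.
congr (_ - _)%:E; have [->|pq] := eqVneq (p + q) 0.
  by rewrite mulr0 mul0r invr0 !mulr0.
by field.
Qed.

Lemma mass_eq_circle A B : measurable A -> measurable B ->
  A `&` sphere 0 = B `&` sphere 0 -> mass A = mass B.
Proof.
by move=> mA mB AB; congr fine; rewrite -mass_circle// AB mass_circle.
Qed.

Lemma moment_eq_circle i A B :
  A `&` sphere 0 = B `&` sphere 0 -> moment i A = moment i B.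
Proof. by move=> AB; rewrite /moment AB. Qed.

Lemma moment1_low t : moment 1 (low t) = 0.
Proof.
apply: moment1_eq0 => //; first exact: measurable_low.
by move=> x; rewrite /low /first_coord/= refl_coord0 mulr1 mulr0 addr0.
Qed.

Lemma moment1_lowC t : moment 1 (~` low t) = 0.
Proof.
apply: moment1_eq0 => //; first by apply: measurableC; exact: measurable_low.
by move=> x; rewrite /low /first_coord/= refl_coord0 mulr1 mulr0 addr0.
Qed.

(** On the circle this half-plane contains at most the point (-1, 0). *)
Lemma mass_low_leN1 (t : R) : t <= -1 -> mass (low t) = 0.
Proof.
move=> t1; apply/eqP; rewrite eq_le mass_ge0 andbT.
rewrite (_ : 0 = mass (@first_coord R @^-1` [set -1])); last by rewrite /mass level_null.
rewrite (_ : mass (low t) = mass (low t `&` sphere 0)); last first.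
  by congr fine; rewrite mass_circle//; exact: measurable_low.
apply: le_mass.
- apply: measurableI; [exact: measurable_low|exact: measurable_circle].
- exact: measurable_funPTI.
move=> x [xt /(circle_coord_le1 0)]; rewrite ler_norml => /andP[h _].
by apply/eqP; rewrite eq_le h andbT; exact: le_trans xt t1.
Qed.

(** The decrease of the error from its value 2 for a single cluster, whose best
    center is the origin. *)
Definition gain (P M : R) : R := (P - M) ^+ 2 / (P * (2 - P)).

(** Translated to the origin, the first piece is the part x_0 <= 1 - a of the left
    circle and a null part of the right circle, and the second piece is the
    complement of these. *)
Lemma cutoff_errorE (a : R) : 0 <= a -> cutoff_error sigma a =
  (2 - gain (mass (low (1 - a))) (moment 0 (low (1 - a))))%:E.
Proof.
move=> a0; set P := mass _; set M := moment _ _.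
set S1 := [set x : 'rV[R]_2 | two_spheres x /\ x 0 0 <= - a].
have mS : measurable (two_spheres : set V).
  by apply: measurableU; exact: measurable_sphere.
have mS1 : measurable (S1 : set V).
  by apply: measurableI => //; exact: (measurable_low (- a)).
have mS2 : measurable ((two_spheres : set V) `\` S1) by exact: measurableD.
have ms b A : measurable A -> measurable (shift_e1 b @^-1` A : set V).
  by move=> mA; rewrite -[X in measurable X]setTI; exact: measurable_shift_e1.
have inm (x : V) : sphere 0 (x : 'rV[R]_2) -> two_spheres (shift_e1 (-1) x).
  by move=> /circleP x1; left; apply/in_sphere;
    rewrite shift_coord0 shift_coord1 -x1; ring.
have inp (x : V) : sphere 0 (x : 'rV[R]_2) -> two_spheres (shift_e1 1 x).
  by move=> /circleP x1; right; apply/in_sphere;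
    rewrite shift_coord0 shift_coord1 -x1; ring.
have E1m : shift_e1 (-1) @^-1` S1 `&` sphere 0 = low (1 - a) `&` sphere 0.
  apply/seteqP; split => x /= [H Tx]; split=> //.
    by case: H => _; rewrite shift_coord0 /low /= /first_coord; lra.
  split; first exact: inm.
  by rewrite shift_coord0; move: H; rewrite /low /= /first_coord; lra.
have E1p : shift_e1 1 @^-1` S1 `&` sphere 0 = low (- 1 - a) `&` sphere 0.
  apply/seteqP; split => x /= [H Tx]; split=> //.
    by case: H => _; rewrite shift_coord0 /low /= /first_coord; lra.
  split; first exact: inp.
  by rewrite shift_coord0; move: H; rewrite /low /= /first_coord; lra.
have E2m : shift_e1 (-1) @^-1` (two_spheres `\` S1) `&` sphere 0 =
    ~` low (1 - a) `&` sphere 0.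
  apply/seteqP; split => x /= [H Tx]; split=> //.
    case: H => ts nS h; apply: nS; split=> //.
    by rewrite shift_coord0; move: h; rewrite /low /= /first_coord; lra.
  split; first exact: inm.
  move=> [_]; rewrite shift_coord0 => h; apply: H.
  by rewrite /low /= /first_coord; lra.
have E2p : shift_e1 1 @^-1` (two_spheres `\` S1) `&` sphere 0 =
    ~` low (- 1 - a) `&` sphere 0.
  apply/seteqP; split => x /= [H Tx]; split=> //.
    case: H => ts nS h; apply: nS; split=> //.
    by rewrite shift_coord0; move: h; rewrite /low /= /first_coord; lra.
  split; first exact: inp.
  move=> [_]; rewrite shift_coord0 => h; apply: H.
  by rewrite /low /= /first_coord; lra.
have ml t : measurable (low t : set V) by exact: measurable_low.
have mlC t : measurable (~` low t : set V) by exact: measurableC.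
have q0 : mass (low (- 1 - a)) = 0 by apply: mass_low_leN1; lra.
have m0 : moment 0 (low (- 1 - a)) = 0.
  by apply/eqP; rewrite -normr_le0 -q0; exact: moment0_le_mass.
rewrite /cutoff_error /mse -/S1.
rewrite (@part_errorE S1 P M 0 0)//; last 6 first.
- by apply: mass_eq_circle => //; exact: ms.
- exact: moment_eq_circle.
- by rewrite -(moment1_low (1 - a)); exact: moment_eq_circle.
- by rewrite -q0; apply: mass_eq_circle => //; exact: ms.
- by rewrite -m0; exact: moment_eq_circle.
- by rewrite -(moment1_low (- 1 - a)); exact: moment_eq_circle.
rewrite (@part_errorE (two_spheres `\` S1) (1 - P) (- M) 1 0)//; last 6 first.
- by rewrite -massC//; apply: mass_eq_circle => //; exact: ms.
- by rewrite -momentC//; exact: moment_eq_circle.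
- by rewrite -(moment1_lowC (1 - a)); exact: moment_eq_circle.
- transitivity (mass (~` low (- 1 - a))); last by rewrite massC// q0 subr0.
  by apply: mass_eq_circle => //; exact: ms.
- transitivity (moment 0 (~` low (- 1 - a))); last by rewrite momentC// m0 oppr0.
  exact: moment_eq_circle.
- by rewrite -(moment1_lowC (- 1 - a)); exact: moment_eq_circle.
rewrite -EFinD; congr EFin; rewrite /gain.
have P1 : P <= 1 by rewrite /P -subr_ge0 -massC// mass_ge0.
have [P0|PN0] := eqVneq P 0; last first.
  by field; rewrite PN0 andbT gt_eqF//; lra.
(* For P = 0 both sides are 2 by the convention on division by zero. *)
have M0 : M = 0.
  by apply/eqP; rewrite -normr_le0 -P0; exact: moment0_le_mass.
by rewrite P0 M0 !(mul0r, invr0, mulr0, subr0, addr0, subrr, oppr0, expr0n)/=; lra.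
Qed.

End error.

(** * Maximizing the gain *)

(** With d = 1 - p the mass of a cap of height a = 21/1000, p (2 - p) = 1 - d^2 and
    p - m >= 1 - a d, so the gain exceeds 1 when d > 2 a. *)
Lemma gain_gt1 (R : realType) (p m : R) : 0 < p -> 1 / 16 <= 1 - p ->
  979 / 1000 * (1 - p) <= - m -> 1 < gain p m.
Proof.
move=> p0 d16 md; rewrite /gain ltr_pdivlMr ?mul1r; last by apply: mulr_gt0; lra.
apply: (@lt_le_trans _ _ ((1 - 21 / 1000 * (1 - p)) ^+ 2)); first by nra.
by rewrite ler_sqr ?nnegrE; lra.
Qed.

Section optimum.
Context (R : realType) (sigma : probability (borel_rV R 2) R).
Context (sigmaP : is_uniform_on_sphere sigma).
Local Notation mass := (mass sigma).
Local Notation moment := (moment sigma).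

Let P (a : R) := mass (low (1 - a)).
Let M (a : R) := moment 0 (low (1 - a)).
(* The constant 1/4 only has to be small enough for the gain to be below 1
   whenever P < 1/4, and to be at most the value of P at a cutoff of gain > 1. *)
Let clipped_gain (a : R) :=
  (P a - M a) ^+ 2 / (Num.max (P a) 4^-1 * (2 - P a)).

Let P_ge0 a : 0 <= P a. Proof. exact: mass_ge0. Qed.

Let P_le1 a : P a <= 1.
Proof. by rewrite /P -subr_ge0 -massC ?mass_ge0//; exact: measurable_low. Qed.

Let norm_M_le a : `|M a| <= P a.
Proof. by apply: moment0_le_mass => //; exact: measurable_low. Qed.

Let sq_le a : (P a - M a) ^+ 2 <= 4 * P a ^+ 2.
Proof.
have := norm_M_le a; rewrite ler_norml => /andP[h1 h2].
have := P_ge0 a; nra.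
Qed.

Lemma clipped_gain_continuous : continuous clipped_gain.
Proof.
have c1 : continuous (fun a : R => 1 - a).
  by move=> a; apply: cvgB; [exact: cvg_cst|exact: cvg_id].
have cP : continuous P.
  move=> a; apply: (@continuous_comp _ _ _ _ (fun t => mass (low t)) a (c1 a)).
  exact: mass_low_continuous.
have cM : continuous M.
  move=> a.
  apply: (@continuous_comp _ _ _ _ (fun t => moment 0 (low t)) a (c1 a)).
  exact: moment_low_continuous.
move=> a; apply: cvgM.
  rewrite expr2; under eq_fun do rewrite expr2.
  by apply: cvgM; apply: cvgB; [exact: cP|exact: cM|exact: cP|exact: cM].
have := P_le1 a => Pa1.
apply: cvgV.
  by rewrite mulf_neq0// gt_eqF//; [rewrite lt_max invr_gt0 ltr0n orbT|lra].
apply: cvgM; last by apply: cvgB; [exact: cvg_cst|exact: cP].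
have cst4 : (fun=> 4^-1 : R) x @[x --> a] --> (4^-1 : R) by exact: cvg_cst.
apply: (@continuous2_cvg _ R R R _ _ P _ Num.max _ _ _ (cP a) cst4).
exact: (@max_continuous _ R (P a, 4^-1)).
Qed.

Lemma clipped_gainE a : 4^-1 <= P a -> clipped_gain a = gain (P a) (M a).
Proof. by move=> h; rewrite /clipped_gain max_l. Qed.

Lemma clipped_gain_lt1 a : P a < 4^-1 -> clipped_gain a < 1.
Proof.
move=> h; rewrite /clipped_gain max_r ?(ltW h)//.
have := sq_le a; have := P_ge0 a => P0 sq.
rewrite ltr_pdivrMr ?mul1r; first by nra.
by apply: mulr_gt0; lra.
Qed.

Lemma gain_lt1 a : P a < 4^-1 -> gain (P a) (M a) < 1.
Proof.
move=> h; rewrite /gain.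
have [->|PN0] := eqVneq (P a) 0; first by rewrite mul0r invr0 mulr0.
have Pp : 0 < P a by rewrite lt_def PN0 P_ge0.
have := sq_le a => sq.
rewrite ltr_pdivrMr ?mul1r; first by nra.
by apply: mulr_gt0; lra.
Qed.

Lemma gain_at0 : gain (P 0) (M 0) = 1.
Proof.
have m1 := measurable_low (1 : R).
have P1 : mass (low 1) = 1.
  by rewrite mass_low_symmetric// mass_low_leN1// subr0.
have M0 : M 0 = 0.
  apply/eqP; rewrite -normr_le0 /M subr0 -normrN -momentC//.
  have mC := measurableC m1.
  by rewrite (le_trans (moment0_le_mass _ mC))// massC// P1 subrr.
by rewrite M0 /P subr0 P1 /gain; field.
Qed.

Lemma P_at2 : P 2 = 0.
Proof. by apply: mass_low_leN1 => //; lra. Qed.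

(** The half-plane x_0 <= 0 has mass 1/2 by symmetry. *)
Lemma P_small_ge_quarter : 4^-1 <= P (21 / 1000).
Proof.
have h := mass_high_low sigmaP 0; have := mass_highE sigmaP 0.
rewrite h oppr0 => h0.
have : mass (low 0) <= P (21 / 1000).
  apply: le_mass; [exact: measurable_low|exact: measurable_low|].
  by move=> x; rewrite /low /=; lra.
lra.
Qed.

Lemma gain_small : 1 < gain (P (21 / 1000)) (M (21 / 1000)).
Proof.
have aE : 1 - 21 / 1000 = 979 / 1000 :> R by field.
have mlow := measurable_low (979 / 1000 : R).
have dE : mass (~` low (979 / 1000)) = 1 - P (21 / 1000).
  by rewrite massC// /P aE.
apply: gain_gt1.
- by apply: lt_le_trans P_small_ge_quarter; rewrite invr_gt0.
- by rewrite /P aE -mass_highE//; exact: small_cap_mass.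
- rewrite -dE /M aE -momentC//; apply: ge_moment0 => //.
    exact: measurableC.
  move=> x /= /negP; rewrite -ltNge => /ltW; exact.
Qed.

(** A maximizer of the clipped gain has value above 1, hence P >= 1/4 there and the
    clipping is inactive; wherever the clipping is active the gain is below 1. *)
Lemma exists_max_gain : exists a : R,
  [/\ 0 < a < 2, 1 < gain (P a) (M a) &
      forall b, 0 <= b <= 2 -> gain (P b) (M b) <= gain (P a) (M a)].
Proof.
have [||c] := @EVT_max R clipped_gain 0 2; first by lra.
  exact/continuous_subspaceT/clipped_gain_continuous.
rewrite in_itv/= => /andP[c0 c2] cmax.
have c_gt1 : 1 < clipped_gain c.
  apply: (lt_le_trans gain_small); rewrite -clipped_gainE; last exact: P_small_ge_quarter.
  by apply: cmax; rewrite in_itv/=; lra.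
have Pc : 4^-1 <= P c.
  by rewrite leNgt; apply/negP => /clipped_gain_lt1; lra.
rewrite (clipped_gainE Pc) in c_gt1 cmax.
exists c; split=> // [|b b02].
  apply/andP; split; rewrite lt_neqAle.
    rewrite c0 andbT eq_sym; apply/negP => /eqP cE.
    by move: c_gt1; rewrite cE gain_at0 ltxx.
  rewrite c2 andbT; apply/negP => /eqP cE.
  by move: Pc; rewrite cE P_at2; lra.
have [Pb|/gain_lt1/ltW h] := leP 4^-1 (P b).
  by rewrite -clipped_gainE//; apply: cmax; rewrite in_itv.
exact: le_trans h (ltW c_gt1).
Qed.

End optimum.

Theorem theorem2p3 (R : realType) (sigma : probability (borel_rV R 2) R)
    (sigmaP : is_uniform_on_sphere sigma) :
  exists a : R,
    [/\ 0 <= a < 2, a != 0,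
        (forall b : R, 0 <= b < 2 ->
           (cutoff_error sigma a <= cutoff_error sigma b)%E) &
        (cutoff_error sigma a < cutoff_error sigma 0)%E].
Proof.
have [a [/andP[a0 a2] a1 amax]] := exists_max_gain sigmaP.
exists a; split.
- by rewrite ltW.
- by rewrite gt_eqF.
- move=> b /andP[b0 b2]; rewrite !cutoff_errorE// ?(ltW a0)//.
  by rewrite lee_fin lerD2l lerN2; apply: amax; rewrite b0 ltW.
- rewrite !cutoff_errorE// ?(ltW a0)// lte_fin ltrD2l ltrN2.
  by rewrite (gain_at0 sigmaP).
Qed.
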